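(* Let $A$ be a finite nonempty alphabet, let $S\subset A^*$ be a recurrent tree set, let $X\subset S$ be a finite $S$-maximal bifix code and let $f:B^*\to A^*$ be a coding morphism for $X$. Then $f^{-1}(S)$ is a tree set.
   Context: A set $T$ of words is factorial if it contains all factors of its elements; $S$ is recurrent if $S\ne\{1\}$, $S$ is factorial and for all $u,w\in S$ there is $v\in S$ with $uvw\in S$. For $w\in T$: $L(w)$, $R(w)$ are the sets of letters $a$ with $aw\in T$, resp. $wa\in T$, and $E(w)=\{(a,b)\mid awb\in T\}$; $T$ is biextendable if factorial and $E(w)\ne\emptyset$ for all $w$. The extension graph of $w$ is the undirected bipartite graph with vertex set the disjoint union of $L(w)$ and $R(w)$ and an edge $a$–$b$ for each $(a,b)\in E(w)$; $T$ is a tree set if biextendable and all extension graphs are trees. A bifix code is a set of nonempty words containing no proper prefix and no proper suffix of its elements; a bifix code $X\subset S$ is $S$-maximal if it is not properly contained in any bifix code $Y\subset S$. A coding morphism for $X$ is a monoid morphism $f:B^*\to A^*$ mapping the alphabet $B$ bijectively onto $X$. *)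

(* Defs.v *)
From HB Require Import structures.
From mathcomp Require Import all_boot.
From mathcomp Require Import boolp classical_sets functions cardinality.

Set Implicit Arguments.
Unset Strict Implicit.
Unset Printing Implicit Defensive.

Local Open Scope classical_set_scope.

Section Words.
Variable A : finType.
Implicit Types (T S X : set (seq A)) (u v w x y : seq A).

Definition factorial_set T : Prop := forall u w, T w -> infix u w -> T u.

Definition recurrent S : Prop :=
  [/\ S <> [set [::]],
      factorial_set S
    & forall u w, S u -> S w -> exists2 v, S v & S (u ++ v ++ w)].

Definition left_ext T w : set A := [set a | T (a :: w)].
Definition right_ext T w : set A := [set b | T (rcons w b)].
Definition bi_ext T w : set (A * A) := [set p | T (p.1 :: rcons w p.2)].

Definition biextendable T : Prop :=
  factorial_set T /\ forall w, T w -> bi_ext T w !=set0.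

(* The sum type keeps the left and right copies of a letter distinct. *)
Definition ext_vertex T w : finType :=
  ({a : A | a \in left_ext T w} + {b : A | b \in right_ext T w})%type.

Definition ext_edge T w : rel (ext_vertex T w) :=
  fun p q => match p, q with
  | inl a, inr b | inr b, inl a => (val a, val b) \in bi_ext T w
  | _, _ => false
  end.

Definition proper_prefix u w : bool := prefix u w && (u != w).
Definition proper_suffix u w : bool := suffix u w && (u != w).

Definition bifix_code X : Prop :=
  [/\ forall x, X x -> x <> [::],
      forall x y, X x -> X y -> ~~ proper_prefix x y
    & forall x y, X x -> X y -> ~~ proper_suffix x y].

Definition maximal_bifix_code S X : Prop :=
  [/\ bifix_code X,
      X `<=` S
    & forall Y, bifix_code Y -> Y `<=` S -> ~ X `<` Y].

End Words.

(* For a symmetric irreflexive e. A cycle is a closed path through at least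
   three pairwise distinct vertices: ucycle alone also accepts x - y - x. *)
Definition is_tree (V : finType) (e : rel V) : Prop :=
  [/\ 0 < #|V|,
      forall x y : V, connect e x y
    & forall c : seq V, 2 < size c -> ~ ucycle e c].

Definition tree_set (A : finType) (T : set (seq A)) : Prop :=
  biextendable T /\ forall w, T w -> is_tree (@ext_edge A T w).

Definition coding_morphism (A B : finType) (X : set (seq A))
    (f : seq B -> seq A) : Prop :=
  [/\ f [::] = [::],
      forall u v, f (u ++ v) = f u ++ f v
    & set_bij [set: B] X (fun b => f [:: b])].

(* Main.v *)
(* Give the extension graph of [w] a version in which [w] is extended by elements
   of [X] on both sides: for [w = f z] it is the extension graph of [z] in
   [f^-1(S)]. A bipartite graph is a tree when its H^0 and H^1 over the field
   with two elements are those of a point: boolean functions that agree across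
   edges are constant, and the only edge set meeting every vertex evenly is
   empty. In this form being a tree passes from single letters to a complete
   finite prefix code [V] on the right by descending the prefix tree of [V]: an
   even edge set sums, over the words of [V] below each letter, to an even edge
   set for letters, hence to zero, so its restriction below each letter is again
   even. Reversal gives the left side. The descent needs [X] to be complete on
   both sides, which follows from maximality and recurrence. *)

Require Import Defs.
From mathcomp Require Import all_boot.
From mathcomp Require Import boolp classical_sets functions cardinality.

Set Implicit Arguments.
Unset Strict Implicit.
Unset Printing Implicit Defensive.

Local Open Scope classical_set_scope.

(** * Sums over the field with two elements *)

Lemma addb_big_witness (I : finType) (P : pred I) (F : I -> bool) :
  \big[addb/false]_(i | P i) F i -> exists2 i, P i & F i.
Proof.
move=> h; case: (pickP (fun i => P i && F i)) => [i /andP[Pi Fi]|F0]; first by exists i.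
by move: h; rewrite big1 // => i Pi; have := F0 i; rewrite Pi.
Qed.

Lemma addb_big_pair (I : finType) (F : I -> bool) i j : i != j ->
  (forall k, F k = (k == i) || (k == j)) -> \big[addb/false]_k F k = false.
Proof.
move=> ij Fij; rewrite (bigD1 i) //= (bigD1 j) 1?eq_sym //= big1.
  by rewrite !Fij !eqxx orbT.
by move=> k /andP[ki kj]; rewrite Fij (negbTE ki) (negbTE kj).
Qed.

(** * Cycles and even edge sets in finite graphs *)

Section Graphs.
Variables (V : finType) (e : rel V).
Hypothesis e_sym : symmetric e.

(** Meant for the support of a nonzero even edge set, in which no vertex has degree one. *)
Lemma ucycle_of_leafless x y :
    (forall x y, e x y -> exists2 z, z != y & e x z) -> irreflexive e ->
  e x y -> exists2 s, 2 < size s & ucycle e s.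
Proof.
move=> leafless irr exy.
(* Extend a simple path at its head until a neighbour of the head lies on it. *)
suff H k : forall x y p, path e x (y :: p) -> uniq (x :: y :: p) ->
    #|V| < k + size (x :: y :: p) -> exists2 s, 2 < size s & ucycle e s.
  apply: (H #|V| x y [::]) => /=; first by rewrite exy.
    by rewrite inE andbT; apply: contraTneq exy => ->; rewrite irr.
  by rewrite addnS ltnS leq_addr.
elim: k => [|k IHk] {exy} {}x {}y p pth unq ltV.
  by have := card_uniqP unq; have := max_card (mem (x :: y :: p)) => + eqs;
    rewrite eqs leqNgt ltV.
have [z zy exz] : exists2 z, z != y & e x z.
  by apply: leafless; case/andP: pth.
have [zs|zNs] := boolP (z \in x :: y :: p); last first.
  apply: (IHk z x (y :: p)); last by rewrite /= addnS -addSn.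
    by apply/andP; split; rewrite // e_sym.
  by rewrite cons_uniq zNs.
have zp : z \in p.
  move: zs; rewrite !inE (negbTE zy) /=; case/orP => // /eqP zx.
  by rewrite zx irr in exz.
case/splitPr: zp pth unq {ltV} => p1 p2 pth unq.
exists (x :: y :: rcons p1 z); first by rewrite /= size_rcons.
have def_s : x :: y :: p1 ++ z :: p2 = (x :: y :: rcons p1 z) ++ p2.
  by rewrite /= cat_rcons.
apply/andP; split; last by move: unq; rewrite def_s cat_uniq => /and3P[].
move: pth; rewrite -cat_rcons -cat_cons cat_path => /andP[pth _].
by rewrite /cycle rcons_path pth last_cons last_rcons e_sym.
Qed.

(** A vertex on the cycle has exactly its successor and its predecessor as neighbours along it, and
    these differ because the length exceeds two. *)
Lemma ucycle_even_degree s x : 2 < size s -> ucycle e s ->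
  \big[addb/false]_y [&& x \in s, y \in s & (next s x == y) || (next s y == x)]
  = false.
Proof.
move=> s2 /andP[_ us].
have [xs|xNs] /= := boolP (x \in s); last by rewrite big1.
apply: (@addb_big_pair _ _ (next s x) (prev s x)) => [|y]; last first.
  have [ys|yNs] /= := boolP (y \in s).
    rewrite eq_sym; congr (_ || _); apply/eqP/eqP => [<-|->].
      by rewrite prev_next.
    by rewrite next_prev.
  by apply/esym/negbTE; rewrite negb_or; apply/andP; split;
    apply: contraNneq yNs => ->; rewrite ?mem_next ?mem_prev.
apply/eqP => nxp.
have nnx : next s (next s x) = x by rewrite nxp next_prev.
case/rot_to: xs => i s' rs.
have us' : uniq (x :: s') by rewrite -rs rot_uniq.
move: nnx; rewrite -!(next_rot i us) rs.
have : 2 < size (x :: s') by rewrite -rs size_rot.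
case: s' us' {rs} => [|y [|z s']] //= /andP[xN /andP[yN _]] _.
rewrite eqxx /=; have /negbTE-> : y != x.
  by apply: contraNneq xN => ->; rewrite inE eqxx.
by rewrite eqxx => zx; rewrite -zx !inE eqxx orbT in xN.
Qed.

End Graphs.

(** * Homological connectedness and acyclicity of bipartite graphs *)

Section Bipartite.
Variables (I J : finType).
Implicit Types (P : I -> Prop) (Q : J -> Prop) (r : I -> J -> Prop).

(** [P] and [Q] single out the indices that are vertices, so that an isolated vertex counts while an
    index outside the graph does not. *)
Definition bip_connected P Q r : Prop :=
  forall (g : I -> bool) (h : J -> bool), (forall i j, r i j -> g i = h j) ->
  exists b, (forall i, P i -> g i = b) /\ (forall j, Q j -> h j = b).

(* Triviality of the cycle space over the field with two elements. *)
Definition bip_acyclic r : Prop :=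
  forall c : I -> J -> bool, (forall i j, c i j -> r i j) ->
    (forall i, \big[addb/false]_j c i j = false) ->
    (forall j, \big[addb/false]_i c i j = false) ->
  forall i j, c i j = false.

End Bipartite.

Lemma bip_connectedC (I J : finType) (P : I -> Prop) (Q : J -> Prop)
    (r : I -> J -> Prop) :
  bip_connected P Q r -> bip_connected Q P (fun j i => r i j).
Proof.
move=> con h g hg; have [|b [gb hb]] := con g h; last by exists b.
by move=> i j rij; rewrite (hg j i).
Qed.

Lemma bip_acyclicC (I J : finType) (r : I -> J -> Prop) :
  bip_acyclic r -> bip_acyclic (fun j i => r i j).
Proof. by move=> acy c cr c1 c2 j i; apply: (acy (fun i j => c j i)) => // ? ?; apply: cr. Qed.

(** * The homological criterion for extension graphs to be trees *)

Section ExtensionGraph.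
Variables (A : finType) (T : set (seq A)) (w : seq A).
Hypothesis T_fact : factorial_set T.

Let P a := T (a :: w).
Let Q b := T (rcons w b).
Let r a b := T (a :: rcons w b).

Lemma edge_left a b : r a b -> a \in left_ext T w.
Proof.
move=> rab; rewrite inE; apply: T_fact rab _.
by rewrite -rcons_cons -cats1; apply: prefixW; apply: prefix_prefix.
Qed.

Lemma edge_right a b : r a b -> b \in right_ext T w.
Proof.
move=> rab; rewrite inE; apply: T_fact rab _.
by rewrite -cat1s; apply: suffixW; apply: suffix_suffix.
Qed.

Lemma ext_edge_sym : symmetric (@ext_edge A T w).
Proof. by move=> [x|x] [y|y]. Qed.

Lemma is_tree_connected : is_tree (@ext_edge A T w) -> bip_connected P Q r.
Proof.
case=> /card_gt0P[x0 _] con _ g h gh.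
pose k (x : ext_vertex T w) := match x with inl a => g (val a) | inr b => h (val b) end.
have kE x y : ext_edge x y -> k x = k y.
  by case: x y => [a|b] [a'|b'] //=; rewrite inE => /gh.
have kC x : k x = k x0.
  have /connectP[p pth ->] := con x0 x.
  by elim: p x0 pth {con} => //= y p IHp x0 /andP[/kE-> /IHp].
exists (k x0); split=> [a Pa|b Qb].
  have aL : a \in left_ext T w by rewrite inE.
  by rewrite -(kC (inl (exist _ a aL))).
have bR : b \in right_ext T w by rewrite inE.
by rewrite -(kC (inr (exist _ b bR))).
Qed.

Lemma is_tree_acyclic : is_tree (@ext_edge A T w) -> bip_acyclic r.
Proof.
case=> _ _ acy c cr c1 c2 a b; apply/negP => cab.
pose e (x y : ext_vertex T w) := match x, y with
  | inl a, inr b | inr b, inl a => c (val a) (val b) | _, _ => false end.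
have e_sub : subrel e (@ext_edge A T w).
  by move=> [x|x] [y|y] //= /cr; rewrite inE.
have e_sym : symmetric e by move=> [x|x] [y|y].
have irr : irreflexive e by move=> [].
(* A sum modulo two that vanishes and has a nonzero term has another one: the support of [c] has no
   leaf, hence contains a cycle. *)
have other (F : A -> bool) i : \big[addb/false]_j F j = false -> F i ->
    exists2 j, j != i & F j.
  by move=> + Fi; rewrite (bigD1 i) //= Fi addTb => /negbFE/addb_big_witness.
have leafless x y : e x y -> exists2 z, z != y & e x z.
  case: x y => [x|x] [y|y] //= cxy.
    have [z zy cz] := other _ _ (c1 _) cxy.
    by exists (inr (exist _ z (edge_right (cr _ _ cz)))).
  have [z zy cz] := other (c^~ (val x)) _ (c2 _) cxy.
  by exists (inl (exist _ z (edge_left (cr _ _ cz)))).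
have [s s2] := ucycle_of_leafless e_sym leafless irr
  (cab : e (inl (exist _ a (edge_left (cr _ _ cab))))
           (inr (exist _ b (edge_right (cr _ _ cab))))).
case/andP=> cyc us; apply: (acy s s2); rewrite /ucycle us andbT.
exact: sub_cycle cyc.
Qed.

Lemma bip_is_tree : (exists a b, r a b) ->
  bip_connected P Q r -> bip_acyclic r -> is_tree (@ext_edge A T w).
Proof.
move=> [a0 [b0 r0]] con acy; split=> [|x y|s s2 /andP[cyc us]].
- by apply/card_gt0P; exists (inl (exist _ a0 (edge_left r0))).
(* [g] and [h] are the indicator functions of the connected component of [x], set to false at
   letters that are not vertices. *)
- pose g a := [exists z : ext_vertex T w, connect (@ext_edge A T w) x z &&
     (if z is inl a' then val a' == a else false)].
  pose h b := [exists z : ext_vertex T w, connect (@ext_edge A T w) x z &&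
     (if z is inr b' then val b' == b else false)].
  have gE a : g (val a) = connect (@ext_edge A T w) x (inl a).
    apply/existsP/idP => [[[z|z]]|xa]; last by exists (inl a); rewrite xa /=.
      by case/andP=> + /eqP/val_inj <-.
    by rewrite andbF.
  have hE b : h (val b) = connect (@ext_edge A T w) x (inr b).
    apply/existsP/idP => [[[z|z]]|xb]; last by exists (inr b); rewrite xb /=.
      by rewrite andbF.
    by case/andP=> + /eqP/val_inj <-.
  have [|c [gc hc]] := con g h.
    move=> a b rab.
    rewrite (gE (exist _ a (edge_left rab))) (hE (exist _ b (edge_right rab))).
    by apply: (same_connect_r (sym_connect_sym ext_edge_sym)); apply: connect1;
      rewrite /= inE.
  have kc z : connect (@ext_edge A T w) x z = c.
    case: z => [[a aL]|[b bR]]; rewrite -?gE -?hE.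
      exact: gc (set_mem aL).
    exact: hc (set_mem bR).
  by rewrite kc -(kc x) connect0.
(* The cycle is moved to [A + A], so that degrees become sums over all letters instead of subtypes;
   its edge set [d] is then even, hence empty. *)
pose m (z : ext_vertex T w) : A + A :=
  match z with inl a => inl (val a) | inr b => inr (val b) end.
have m_inj : injective m by move=> [x|x] [y|y] //= [] /val_inj->.
pose e (x y : A + A) := match x, y with
  | inl a, inr b | inr b, inl a => `[< r a b >] | _, _ => false end.
have e_sym : symmetric e by move=> [x|x] [y|y].
have ucyc : ucycle e (map m s).
  rewrite /ucycle map_inj_uniq // us andbT cycle_map.
  by apply: sub_cycle cyc => -[x|x] [y|y] //=; rewrite inE => rxy; apply/asboolP.
have s2' : 2 < size (map m s) by rewrite size_map.
set t := map m s in ucyc s2'.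
pose d x y := [&& x \in t, y \in t & (next t x == y) || (next t y == x)].
have d_sum x : \big[addb/false]_y d x y = false by apply: ucycle_even_degree ucyc.
have d_sym x y : d x y = d y x by rewrite /d andbCA orbC.
have de x y : d x y -> e x y.
  case/andP: ucyc => cyt _ /and3P[xt yt /orP[/eqP<-|/eqP<-]].
    exact: next_cycle.
  by rewrite e_sym; apply: next_cycle.
have dll a b : d (inl a) (inl b) = false by apply/negP=> /de.
have drr a b : d (inr a) (inr b) = false by apply/negP=> /de.
have d0 a b : d (inl a) (inr b) = false.
  apply: (acy (fun a b => d (inl a) (inr b))).
  - by move=> i j /de/asboolP.
  - by move=> i; rewrite -[RHS](d_sum (inl i)) big_sumType /= [X in addb X _]big1 // => k _; apply: dll.
  - move=> j; rewrite -[RHS](d_sum (inr j)) big_sumType /= [X in addb _ X]big1 => [|k _]; rewrite ?drr // addbF.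
    by apply: eq_bigr => i _; rewrite d_sym.
have [x xt] : exists x, x \in t by case: (t) s2' => // x ? _; exists x; rewrite inE eqxx.
have : d x (next t x) by rewrite /d xt mem_next xt eqxx.
by case: x (next t x) {xt} => [x|x] [y|y]; rewrite ?dll ?drr ?d0 // d_sym d0.
Qed.

End ExtensionGraph.

(** * Passing from letters to a complete prefix code *)

Section Refinement.
Variables (A : finType) (S : set (seq A)).
Hypothesis S_fact : factorial_set S.

Lemma factorial_catl x y : S (x ++ y) -> S x.
Proof. by move/S_fact; apply; apply: prefixW; apply: prefix_prefix. Qed.

Lemma factorial_catr x y : S (x ++ y) -> S y.
Proof. by move/S_fact; apply; apply: suffixW; apply: suffix_suffix. Qed.

Variables (I J : finType) (u : I -> seq A) (v : J -> seq A) (n : nat).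
Hypothesis v_code : forall i j, prefix (v i) (v j) -> i = j.
Hypothesis v_complete :
  forall x, S x -> n <= size x -> exists j, prefix (v j) x.

Lemma prefix_rcons_ex (p x : seq A) : prefix p x -> p != x ->
  exists a, prefix (rcons p a) x.
Proof.
case/prefixP=> -[|a s] ->; first by rewrite cats0 eqxx.
by exists a; rewrite -cat_rcons prefix_prefix.
Qed.

Lemma prefix_rcons_inj (p x : seq A) a b :
  prefix (rcons p a) x -> prefix (rcons p b) x -> a = b.
Proof.
by rewrite !prefixE !size_rcons => /eqP-> /eqP/rcons_inj[].
Qed.

Lemma code_below p j0 j : prefix (v j0) p -> prefix p (v j) -> j = j0.
Proof. by move=> j0p pj; apply/esym/v_code/(prefix_trans j0p). Qed.

Lemma refine_acyclic w :
    (forall p, S (w ++ p) -> bip_acyclic (fun i a => S (u i ++ (w ++ p) ++ [:: a]))) ->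
  bip_acyclic (fun i j => S (u i ++ w ++ v j)).
Proof.
move=> acy c cr c1 c2.
have supp i j p : c i j -> prefix p (v j) -> S (u i ++ w ++ p).
  by move=> /cr + /prefixP[s vE]; rewrite vE !catA; apply: factorial_catl.
have leaf i p j0 j : prefix (v j0) p -> prefix p (v j) ->
    \big[addb/false]_(j | prefix p (v j)) c i j = false -> c i j = false.
  move=> j0p pj; rewrite (big_pred1 j) // => j'.
  by apply/idP/eqP => [/(code_below j0p)|->] //; rewrite -(code_below j0p pj).
(* Descent along the prefix tree of the code: [k] bounds the depth still available below the node
   [p], and the invariant is that [c], restricted to the code words below [p], stays even at every
   left vertex. *)
suff H k : forall p, n <= size p + k ->
    (forall i, \big[addb/false]_(j | prefix p (v j)) c i j = false) ->
    forall i j, prefix p (v j) -> c i j = false.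
  move=> i j; apply: (H n [::]) => // [{}i|]; last exact: prefix0s.
  by rewrite -[RHS](c1 i); apply: eq_bigl => ?; rewrite prefix0s.
elim: k => [|k IHk] p szp cp i j pj; apply/negP=> cij.
  all: have Swp := factorial_catr (supp _ _ _ cij pj).
  all: have Sp := factorial_catr Swp.
  all: have [[j0 j0p]|noj] := pselect (exists j0, prefix (v j0) p).
- by rewrite (leaf _ _ _ _ j0p pj (cp i)) in cij.
- by case: noj; apply: v_complete; rewrite // addn0 in szp *.
- by rewrite (leaf _ _ _ _ j0p pj (cp i)) in cij.
have next_letter j' : prefix p (v j') -> exists a, prefix (rcons p a) (v j').
  move=> pj'; apply: prefix_rcons_ex => //; apply: contra_notN noj => /eqP->.
  by exists j'; apply: prefix_refl.
pose c' i a := \big[addb/false]_(j | prefix (rcons p a) (v j)) c i j.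
have [a pa] := next_letter _ pj.
suff c'0 i' : c' i' a = false.
  have := IHk (rcons p a) _ c'0 i j pa.
  by rewrite size_rcons addSnnS cij => /(_ szp).
apply: (acy p Swp c') => {i' i j pj cij pa a} [i a|i|a].
- case/addb_big_witness => j pj /supp/(_ pj).
  by rewrite -cats1 !catA.
- rewrite -[RHS](cp i).
  (* With no code word a prefix of [p], every code word below [p] lies below exactly one child of
     [p], so the sums over the children regroup into the sum at [p]. *)
  rewrite (exchange_big_dep (fun j => prefix p (v j))) /= => [|a j _]; last first.
    by apply: prefix_trans; apply: prefix_rcons.
  apply: eq_bigr => j /next_letter[a pa]; rewrite (big_pred1 a) // => b.
  by apply/idP/eqP => [/prefix_rcons_inj/(_ pa)|->].
by rewrite /c' exchange_big big1.
Qed.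

(** Values climb from the leaves of the prefix tree to its root: the code words below each child
    share one value, and connectedness for single letters at [w ++ p] makes the values of the
    children of [p] agree. *)
Lemma refine_connected w : S w ->
    (forall p, S (w ++ p) -> bip_connected
       (fun i => S (u i ++ w ++ p)) (fun a => S ((w ++ p) ++ [:: a]))
       (fun i a => S (u i ++ (w ++ p) ++ [:: a]))) ->
    (forall x, S x -> exists i, S (u i ++ x)) ->
  bip_connected (fun i => S (u i ++ w)) (fun j => S (w ++ v j))
    (fun i j => S (u i ++ w ++ v j)).
Proof.
move=> Sw con u_ext g h gh.
suff H k : forall p, n <= size p + k -> S (w ++ p) -> exists b,
    (forall i, S (u i ++ w ++ p) -> g i = b) /\
    (forall j, prefix p (v j) -> S (w ++ v j) -> h j = b).
  have [||b [gb hb]] := H n [::]; rewrite ?cats0 //.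
  by exists b; split=> [i|j] ?; [apply: gb|apply: hb; rewrite ?prefix0s]; rewrite ?cats0.
elim: k => [|k IHk] p szp Swp.
  all: have Sp := factorial_catr Swp.
  all: have [[j0 j0p]|noj] := pselect (exists j0, prefix (v j0) p).
(* When the code word [v j0] is a prefix of [p], no other code word lies below [p], and every left
   extension of [w ++ p] is also one of [w ++ v j0]. *)
1,3: exists (h j0); split=> [i|j pj _]; last by rewrite (code_below j0p pj).
1,2: by case/prefixP: j0p => s ->; rewrite !catA => /factorial_catl; rewrite -catA => /gh.
  by case: noj; apply: v_complete; rewrite // addn0 in szp *.
(* [h'] assigns to each child its common value; [true] is a filler for letters that do not extend
   [w ++ p] in [S]. *)
have /choice[h' hh'] : forall a, exists b, S (w ++ rcons p a) ->
    (forall i, S (u i ++ w ++ rcons p a) -> g i = b) /\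
    (forall j, prefix (rcons p a) (v j) -> S (w ++ v j) -> h j = b).
  move=> a; have [Sa|nSa] := pselect (S (w ++ rcons p a)); last by exists true.
  have [|b Hb] := IHk (rcons p a) _ Sa; last by exists b.
  by rewrite size_rcons addSnnS.
have [|b [gb hb]] := con p Swp g h'.
  move=> i a; rewrite -catA cats1 => Sia.
  by have [] := hh' a (factorial_catr Sia) => + _; apply.
exists b; split=> // j pj Swj.
have [a pa] : exists a, prefix (rcons p a) (v j).
  apply: prefix_rcons_ex => //; apply: contra_notN noj => /eqP->.
  by exists j; apply: prefix_refl.
have Sa : S (w ++ rcons p a).
  by case/prefixP: pa Swj => s ->; rewrite catA => /factorial_catl.
have [_ /(_ _ pa Swj)->] := hh' a Sa.
by apply: hb; rewrite -catA cats1.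
Qed.

End Refinement.

(** * Reversal of words *)

Section Reversal.
Variable A : finType.
Implicit Types (S X : set (seq A)).

Definition revset S : set (seq A) := [set x | S (rev x)].

Lemma revsetK : involutive revset.
Proof. by move=> S; apply/funext => x; rewrite /revset /= revK. Qed.

Lemma infix_rev (x y : seq A) : infix x y -> infix (rev x) (rev y).
Proof.
by case/infixP=> p [s ->]; rewrite !rev_cat -catA; apply: infix_infix.
Qed.

Lemma factorial_rev S : factorial_set S -> factorial_set (revset S).
Proof. by move=> Sf x y Sy /infix_rev; apply: Sf Sy. Qed.

Lemma recurrent_rev S : recurrent S -> recurrent (revset S).
Proof.
case=> S1 Sf Sr; split; first 1 last.
- exact: factorial_rev.
- move=> x y Sx Sy; have [v Sv Svy] := Sr _ _ Sy Sx.
  by exists (rev v); rewrite /revset /= ?revK // !rev_cat revK -catA.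
move=> S1'; apply: S1; rewrite -[S]revsetK S1'.
by apply/funext => x; apply/propext; split=> [|->] //= /(congr1 rev); rewrite revK.
Qed.

Lemma bifix_code_rev X : bifix_code X -> bifix_code (revset X).
Proof.
case=> X0 Xp Xs; split=> [x Xx x0|x y Xx Xy|x y Xx Xy].
- by apply: X0 Xx _; rewrite x0.
- have := Xs _ _ Xx Xy; rewrite /proper_suffix /proper_prefix /suffix !revK.
  by rewrite (inj_eq (can_inj revK)).
have := Xp _ _ Xx Xy; rewrite /proper_suffix /proper_prefix /suffix.
by rewrite (inj_eq (can_inj revK)).
Qed.

End Reversal.

(** * Extension graphs with words as extensions *)

Section GeneralizedExtensionGraph.
Variable A : finType.
Implicit Types (S : set (seq A)) (I J : finType).

Definition letter (a : A) : seq A := [:: a].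

(** With [letter] on both sides this concerns the ordinary extension graphs. That the graphs have an
    edge at all is treated separately. *)
Definition multi_tree S I J (u : I -> seq A) (v : J -> seq A) : Prop :=
  forall w, S w ->
    bip_connected (fun i => S (u i ++ w)) (fun j => S (w ++ v j))
      (fun i j => S (u i ++ w ++ v j)) /\
    bip_acyclic (fun i j => S (u i ++ w ++ v j)).

Lemma multi_tree_rev S I J (u : I -> seq A) (v : J -> seq A) :
  multi_tree S u v -> multi_tree (revset S) (rev \o v) (rev \o u).
Proof.
move=> tree w /tree[/bip_connectedC con /bip_acyclicC acy].
have -> : (fun j i => revset S ((rev \o v) j ++ w ++ (rev \o u) i)) =
          (fun j i => S (u i ++ rev w ++ v j)).
  by apply/funext => j; apply/funext => i; rewrite /revset /= !rev_cat !revK catA.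
have -> : (fun j => revset S ((rev \o v) j ++ w)) = (fun j => S (rev w ++ v j)).
  by apply/funext => j; rewrite /revset /= !rev_cat !revK.
have -> : (fun i => revset S (w ++ (rev \o u) i)) = (fun i => S (u i ++ rev w)).
  by apply/funext => i; rewrite /revset /= !rev_cat !revK.
by [].
Qed.

Lemma refine_right S I J (u : I -> seq A) (v : J -> seq A) n :
    factorial_set S ->
    (forall i j, prefix (v i) (v j) -> i = j) ->
    (forall x, S x -> n <= size x -> exists j, prefix (v j) x) ->
    (forall x, S x -> exists i, S (u i ++ x)) ->
  multi_tree S u letter -> multi_tree S u v.
Proof.
move=> Sf v_code v_compl u_ext tree w Sw; split.
  by apply: (refine_connected Sf v_code v_compl) => // p /tree[].
by apply: (refine_acyclic Sf v_code v_compl) => p /tree[].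
Qed.

(** Reversal exchanges the two sides and turns suffixes into prefixes, which reduces this to
    [refine_right]. *)
Lemma refine_left S I J (u : I -> seq A) (v : J -> seq A) n :
    factorial_set S ->
    (forall i j, suffix (u i) (u j) -> i = j) ->
    (forall x, S x -> n <= size x -> exists i, suffix (u i) x) ->
    (forall x, S x -> exists j, S (x ++ v j)) ->
  multi_tree S letter v -> multi_tree S u v.
Proof.
move=> Sf u_code u_compl v_ext tree.
have -> : u = rev \o (rev \o u) by apply/funext => i /=; rewrite revK.
have -> : v = rev \o (rev \o v) by apply/funext => i /=; rewrite revK.
rewrite -[S]revsetK; apply: multi_tree_rev; apply: (refine_right (n := n)).
- exact: factorial_rev.
- exact: u_code.
- move=> x Sx xn; have [|i ui] := u_compl _ Sx; first by rewrite size_rev.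
  by exists i; rewrite /suffix revK in ui.
- by move=> x /v_ext[j Sj]; exists j; rewrite /revset /= rev_cat revK.
exact: multi_tree_rev tree.
Qed.

End GeneralizedExtensionGraph.

(** * Completeness of maximal bifix codes *)

Section Completeness.
Variable A : finType.
Implicit Types (S X : set (seq A)) (x y z : seq A).

(** Comparability, rather than having a prefix in [X], accommodates words of [S] too short for that.
    Left completeness is expressed by applying this to [revset S] and [revset X]. *)
Definition right_complete S X : Prop :=
  forall x, S x -> exists2 y, X y & prefix x y || prefix y x.

Lemma prefix_total x y z : prefix x z -> prefix y z -> prefix x y || prefix y x.
Proof.
rewrite !prefixE => /eqP xz /eqP yz; case: (leqP (size x) (size y)) => le.
  by rewrite -{1}yz take_takel // xz eqxx.
by rewrite -{3}xz take_takel 1?ltnW // yz eqxx orbT.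
Qed.

Lemma prefix_size_eq x y : prefix x y -> size y <= size x -> x = y.
Proof. by rewrite prefixE => /eqP + le; rewrite take_oversize. Qed.

Lemma bifix_prefix X x y : bifix_code X -> X x -> X y -> prefix x y -> x = y.
Proof.
by case=> _ Xp _ Xx Xy xy; have := Xp _ _ Xx Xy; rewrite /proper_prefix xy /= negbK => /eqP.
Qed.

Lemma bifix_suffix X x y : bifix_code X -> X x -> X y -> suffix x y -> x = y.
Proof.
by case=> _ _ Xs Xx Xy xy; have := Xs _ _ Xx Xy; rewrite /proper_suffix xy /= negbK => /eqP.
Qed.

(* Otherwise there are [y], [z] comparable to no element of [X] for the prefix,
   resp. suffix, order, and [X] can be enlarged by a word [y v z] of [S]. *)
Lemma maximal_bifix_complete S X : recurrent S -> maximal_bifix_code S X ->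
  right_complete S X \/ right_complete (revset S) (revset X).
Proof.
case=> S1 Sf Sr [Xb XS Xmax]; apply: contrapT => /not_orP[].
move=> /existsNP[y /not_implyP[Sy ny]] /existsNP[z /not_implyP[Sz nz]].
(* Nothing so far excludes that [y] and [z] are empty; inserting [s] keeps the new code word [t]
   nonempty. *)
have [s Ss s0] : exists2 s, S s & s <> [::].
  apply: contrapT => nS; apply: S1; apply/funext => s; apply/propext; split=> [Ss|->].
    by apply: contrapT => s0; apply: nS; exists s.
  exact: Sf Sy (infix0s _).
have [v _ Sv] := Sr _ _ Sy Ss; have [v' _ St] := Sr _ _ Sv Sz.
set t := (y ++ v ++ s) ++ v' ++ rev z in St.
have t0 : t <> [::].
  by move/(congr1 size)/eqP; rewrite !size_cat !addn_eq0 !size_eq0 => /andP[/and3P[_ _ /eqP/s0]].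
have ty x : X x -> prefix x t || prefix t x -> False.
  have yt : prefix y t by rewrite /t -catA; apply: prefix_prefix.
  move=> Xx xt; apply: ny; exists x => //; case/orP: xt => xt.
    exact: prefix_total yt xt.
  by rewrite (prefix_trans yt xt).
have tz x : X x -> suffix x t || suffix t x -> False.
  have zt : prefix z (rev t) by rewrite /t !rev_cat revK -catA; apply: prefix_prefix.
  move=> Xx xt; apply: nz; exists (rev x); rewrite /revset /= ?revK //.
  case/orP: xt => xt; first exact: prefix_total zt xt.
  by rewrite (prefix_trans zt xt).
case: (Xb) => X0 Xp Xs.
apply: (Xmax (X `|` [set t])).
- split=> [x|x x'|x x'].
  + by case=> [/X0//|->].
  + case=> [Xx|->] [Xx'|->]; apply/negP => /andP[xx'].
    * by apply/negP; rewrite negbK; apply/eqP; apply: bifix_prefix Xx Xx' xx'.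
    * by case: (ty x Xx); rewrite xx'.
    * by case: (ty x' Xx'); rewrite xx' orbT.
    * by rewrite eqxx.
  + case=> [Xx|->] [Xx'|->]; apply/negP => /andP[xx'].
    * by apply/negP; rewrite negbK; apply/eqP; apply: bifix_suffix Xx Xx' xx'.
    * by case: (tz x Xx); rewrite xx'.
    * by case: (tz x' Xx'); rewrite xx' orbT.
    * by rewrite eqxx.
- by move=> x [/XS|->].
split=> [x|/(_ t)]; first by left.
by move=> /(_ (or_intror erefl)) Xt; apply: (ty t Xt); rewrite prefix_refl.
Qed.

Lemma complete_prefix S X n x : (forall y, X y -> size y <= n) ->
  right_complete S X -> S x -> n <= size x -> exists2 y, X y & prefix y x.
Proof.
move=> Xn Xc Sx nx; have [y Xy /orP[xy|]] := Xc _ Sx; last by exists y.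
exists y => //; rewrite (prefix_size_eq xy) ?prefix_refl //.
exact: leq_trans (Xn _ Xy) nx.
Qed.

(* Join the position [i] of [W] to [i + size x] when [x] in [X] occurs at [i].
   As [X] is bifix each position has at most one outgoing and at most one
   incoming arrow, so equally many positions lack an outgoing arrow and lack an
   incoming one. By left completeness the latter are all smaller than [n],
   whereas each occurrence of a word [y] comparable to no element of [X] gives
   one of the former. *)
Lemma right_complete_of_left S X n : recurrent S -> bifix_code X ->
    (forall x, X x -> size x <= n) ->
  right_complete (revset S) (revset X) -> right_complete S X.
Proof.
case=> _ Sf Sr Xb Xn Xc y Sy; apply: contrapT => ny.
(* The empty word is comparable to every word. Nonemptiness makes successive copies of [y] start at
   distinct positions. *)
have y0 : 0 < size y.
  rewrite lt0n size_eq0; apply/eqP => y0; apply: ny.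
  have [|x Xx _] := Xc y; first by rewrite y0 in Sy *.
  by exists (rev x); rewrite ?y0 ?prefix0s ?orbT.
(* Recurrence chains [n.+1] copies of [y] into a single word of [S]. *)
have [W SW kW] : exists2 W, S W &
    n < count (fun i => prefix y (drop i W)) (iota 0 (size W).+1).
  elim: n.+1 => [|k [W SW kW]]; first by exists y.
  have [v _ SvW] := Sr _ _ Sy SW; exists (y ++ v ++ W) => //.
  rewrite catA size_cat -addnS iotaD count_cat -addn1 addnC; apply: leq_add.
    rewrite -has_count; apply/hasP; exists 0; last by rewrite drop0 -catA prefix_prefix.
    by rewrite mem_iota size_cat /= add0n ltn_addr.
  rewrite add0n -[X in iota X]addn0 iotaDl count_map; apply: leq_trans kW _.
  by apply: sub_count => i /=; rewrite addnC -drop_drop drop_size_cat.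
(* Positions lie between letters; the end [size W] is included, since an arrow may arrive there. *)
pose ps := iota 0 (size W).+1.
pose inP i := `[< exists2 x, X x & suffix x (take i W) >].
pose outP i := `[< exists2 x, X x & prefix x (drop i W) >].
have noOut : n < count (predC outP) ps.
  apply: leq_trans kW _; apply: sub_count => i /= yi; apply/asboolP => -[x Xx xi].
  by apply: ny; exists x => //; apply: prefix_total yi xi.
have noIn : count (predC inP) ps <= n.
  rewrite -size_filter -[leqRHS](size_iota 0 n); apply: uniq_leq_size.
    by rewrite filter_uniq ?iota_uniq.
  move=> i; rewrite mem_filter !mem_iota /= add0n ltnS => /andP[/asboolP ni iW].
  rewrite ltnNge; apply/negP => le_ni; apply: ni.
  have [|||x Xx] := @complete_prefix (revset S) (revset X) n (rev (take i W)) _ Xc.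
  - by move=> x /Xn; rewrite size_rev.
  - by rewrite /revset /= revK; apply: Sf SW _; apply: prefixW; apply: prefix_take.
  - by rewrite size_rev size_takel.
  by exists (rev x) => //; rewrite /suffix revK.
have in_le_out : count inP ps <= count outP ps.
  have /choice[xi xiP] : forall i, exists x, inP i -> X x /\ suffix x (take i W).
    move=> i; have [/asboolP[x]|] := boolP (inP i); last by exists [::].
    by exists x.
  have dropE i : inP i -> i <= size W ->
      size (xi i) <= i /\ drop (i - size (xi i)) W = xi i ++ drop i W.
    move=> /xiP[_ /suffixP[s sE]] iW.
    have isz : i = size s + size (xi i) by rewrite -size_cat -sE size_takel.
    split; first by rewrite [leqRHS]isz leq_addl.
    have -> : i - size (xi i) = size s by rewrite [X in X - _]isz addnK.
    by rewrite -{1}(cat_take_drop i W) sE -catA drop_size_cat.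
  (* Each arrow is followed back to its source. This is injective: two words of [X] read from the
     same source are comparable prefixes of one word, hence equal. *)
  rewrite -!size_filter -(size_map (fun i => i - size (xi i))).
  apply: uniq_leq_size.
    rewrite map_inj_in_uniq ?filter_uniq ?iota_uniq // => i j.
    rewrite !mem_filter !mem_iota /= !add0n !ltnS => /andP[ini iW] /andP[inj jW] ij.
    have [lei di] := dropE _ ini iW; have [lej dj] := dropE _ inj jW.
    have xij : xi i = xi j.
      have Xi := (xiP _ ini).1; have Xj := (xiP _ inj).1.
      have pi : prefix (xi i) (drop (i - size (xi i)) W) by rewrite di prefix_prefix.
      have pj : prefix (xi j) (drop (i - size (xi i)) W) by rewrite ij dj prefix_prefix.
      case/orP: (prefix_total pi pj); first exact: (bifix_prefix Xb Xi Xj).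
      by move/(bifix_prefix Xb Xj Xi).
    by rewrite -(subnK lei) ij xij subnK.
  move=> _ /mapP[i + ->]; rewrite !mem_filter !mem_iota /= !add0n !ltnS => /andP[ini iW].
  have [_ di] := dropE _ ini iW; rewrite (leq_trans (leq_subr _ _) iW) andbT.
  by apply/asboolP; exists (xi i); [case: (xiP _ ini)|rewrite di prefix_prefix].
have := leq_add in_le_out noIn; rewrite count_predC -(count_predC outP ps).
by rewrite leq_add2l leqNgt noOut.
Qed.

(** A block of [n] letters appended to [w] is long enough to begin with a word of [X]. *)
Lemma complete_extend S X n w : (forall x, X x -> size x <= n) ->
    factorial_set S -> (forall x, S x -> exists b, S (rcons x b)) ->
  right_complete S X -> S w -> exists2 x, X x & S (w ++ x).
Proof.
move=> Xn Sf Sext Xc Sw.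
have [v vn Swv] : exists2 v, size v = n & S (w ++ v).
  elim: n {Xn} => [|n [v vn /Sext[b Sb]]]; first by exists [::]; rewrite ?cats0.
  by exists (rcons v b); rewrite ?size_rcons ?vn // -rcons_cat.
have [x Xx /prefixP[s vE]] : exists2 x, X x & prefix x v.
  by apply: complete_prefix Xn Xc _ _; rewrite ?vn //; apply: factorial_catr Swv.
by exists x => //; apply: (@factorial_catl _ _ Sf _ s); rewrite -catA -vE.
Qed.

End Completeness.

(** * Transfer of the tree property to the decoded set *)

Theorem theorem3p13 (A : finType) (hA : 0 < #|A|)
    (S : set (seq A)) (hSrec : recurrent S) (hStree : tree_set S)
    (X : set (seq A)) (hXfin : finite_set X) (hXmax : maximal_bifix_code S X)
    (B : finType) (f : seq B -> seq A) (hf : coding_morphism X f) :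
  tree_set (f @^-1` S).
Proof.
case: hStree => -[Sf Sbi] Stree; case: hf => f0 fcat [fX finj fsurj].
have [Xb _ _] := hXmax.
pose v b := f [:: b].
have vX b : X (v b) by apply: fX.
have v_inj b c : v b = v c -> b = c by apply: finj; rewrite inE.
have Xv x : X x -> exists b, v b = x by move=> /fsurj[b _]; exists b.
pose n := \max_b size (v b).
have Xn x : X x -> size x <= n.
  by move=> /Xv[b <-]; apply: leq_bigmax.
have X'n x : revset X x -> size x <= n by move/Xn; rewrite size_rev.
have Srec' := recurrent_rev hSrec; have Sf' := factorial_rev Sf.
(* Maximality gives completeness on one of the two sides; the counting argument, or its mirror
   image, gives the other side. *)
have [Xr Xl] : right_complete S X /\ right_complete (revset S) (revset X).
  case: (maximal_bifix_complete hSrec hXmax) => Xc; split=> //.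
    apply: right_complete_of_left Srec' (bifix_code_rev Xb) X'n _.
    by rewrite !revsetK.
  exact: right_complete_of_left hSrec Xb Xn Xc.
have Sright x : S x -> exists b, S (rcons x b).
  move=> /Sbi[[a b] Sab]; exists b.
  exact: (@factorial_catr _ _ Sf [:: a]) Sab.
have Sleft x : S x -> exists a, S (a :: x).
  move=> /Sbi[[a b] Sab]; exists a; apply: (@factorial_catl _ _ Sf _ [:: b]).
  by rewrite cats1.
have ext_right x : S x -> exists b, S (x ++ v b).
  move=> Sx; have [y /Xv[b <-] Sy] := complete_extend Xn Sf Sright Xr Sx.
  by exists b.
have ext_left x : S x -> exists b, S (v b ++ x).
  move=> Sx; have [||y /Xv[b vb]] := @complete_extend _ _ _ n (rev x) X'n Sf' _ Xl.
  - by move=> z /Sleft[a Sa]; exists a; rewrite /revset /= rev_rcons.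
  - by rewrite /revset /= revK.
  by rewrite /revset /= rev_cat -vb revK; exists b.
have Atree : multi_tree S (@letter A) (@letter A).
  move=> w Sw; have tw := Stree w Sw.
  have := conj (is_tree_connected tw) (is_tree_acyclic Sf tw).
  have -> : (fun j => S (w ++ letter j)) = (fun j => S (rcons w j)).
    by apply/funext => j; rewrite cats1.
  have -> // : (fun i j => S (letter i ++ w ++ letter j)) =
               (fun i j => S (i :: rcons w j)).
  by apply/funext => i; apply/funext => j; rewrite cats1.
(* Code words replace letters first on the right, where [X] is a complete prefix code, and then on
   the left, where it is a complete suffix code. *)
have Btree : multi_tree S v v.
  apply: (refine_left (n := n)) => //.
  - by move=> i j /(bifix_suffix Xb (vX i) (vX j))/v_inj.
  - move=> x Sx nx; have [||y /Xv[b vb] yx] := complete_prefix X'n Xl (x := rev x).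
    + by rewrite /revset /= revK.
    + by rewrite size_rev.
    by exists b; rewrite /suffix vb revK.
  apply: (refine_right (n := n)) => //.
  - by move=> i j /(bifix_prefix Xb (vX i) (vX j))/v_inj.
  - by move=> x Sx nx; have [y /Xv[b <-]] := complete_prefix Xn Xr Sx nx; exists b.
have Tbi w : S (f w) -> exists a b, S (f (a :: rcons w b)).
  move=> /ext_right[b] /ext_left[a Sab]; exists a, b.
  by rewrite -cat1s -cats1 !fcat.
have Tf : factorial_set (f @^-1` S).
  move=> x y Sy /infixP[p [s yE]]; apply: Sf Sy _.
  by rewrite yE !fcat; apply: infix_infix.
split=> [|w Sw]; first by split=> // w /Tbi[a [b Sab]]; exists (a, b).
(* Since [f] is a morphism, the graph of [f w] with extensions in [X] is the extension graph of [w]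
   in the preimage, with [B] indexing [X]. *)
have := Btree _ Sw.
have <- : (fun a => S (f (a :: w))) = (fun a => S (v a ++ f w)).
  by apply/funext => a; rewrite -cat1s fcat.
have <- : (fun b => S (f (rcons w b))) = (fun b => S (f w ++ v b)).
  by apply/funext => b; rewrite -cats1 fcat.
have <- : (fun a b => S (f (a :: rcons w b))) = (fun a b => S (v a ++ f w ++ v b)).
  by apply/funext => a; apply/funext => b; rewrite -cat1s -cats1 !fcat.
by case=> con acy; apply: bip_is_tree => //; apply: Tbi.
Qed.
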